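(* Let $t \in M$ with $t \neq 1_M$, regarded as a finite planar binary rooted tree. Then $$\hat{a}(t) = \prod_{a \in I(t)} \binom{n(a)-2}{n_1(a)-1}_M \in \mathbb{N},$$ where $I(t)$ is the set of inner nodes of $t$, and for each $a \in I(t)$, $n(a)$ is the degree of the subtree $t_{\le a}$ and $n_1(a)$ is the degree of the left factor $s_1$ in the unique factorization $t_{\le a} = s_1 \cdot s_2$ with $s_1, s_2 \in M\setminus\{1_M\}$. (An empty product equals $1$.)
   Context: Mersenne notation: for $n \ge 1$ let $M_n = 2^n - 1$. The Mersenne factorial is $n!_M = \prod_{i=1}^n M_i$ (with $0!_M = 1$), and for integers $0 \le r \le n$ the Mersenne binomial is $\binom{n}{r}_M = \frac{n!_M}{r!_M\,(n-r)!_M}$. For $n \ge 1$ put $\omega(n) = \frac{2^{n-1}\,(n-1)!_M}{n!}$. The magma $M$: let $M$ (without index) be the magma with neutral element $1_M$ freely generated by one element $x$ (multiplication neither associative nor commutative). Every $t \in M\setminus\{1_M,x\}$ can be written uniquely as $t = t_1\cdot t_2$ with $t_1,t_2 \in M \setminus\{1_M\}$. The degree $\deg : M \to \mathbb{N}$ is the unique homomorphism with $\deg(1_M)=0$, $\deg(x)=1$ (so $\deg(s\cdot t)=\deg(s)+\deg(t)$). Elements $t \ne 1_M$ of $M$ are identified with finite planar binary rooted trees with $\deg(t)$ leaves: $x$ is the one-node tree, and $t_1 \cdot t_2$ is the tree obtained by grafting, i.e. a new root with left subtree $t_1$ and right subtree $t_2$. For a node $a$ of $t$, $t_{\le a}$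 is the subtree consisting of all nodes $b$ of $t$ for which the simple path from $b$ to the root of $t$ passes through $a$. Inner nodes are the nodes that are not leaves. The non-associative exponential: $\mathbb{Q}\{\{x\}\}$ is the $\mathbb{Q}$-algebra of formal series $\sum_{t\in M} c(t)\, t$, $c(t) \in \mathbb{Q}$, with product extending that of $M$. There is a unique series $\exp(x) = \sum_{t \in M} a(t)\, t \in \mathbb{Q}\{\{x\}\}$ of the form $1 + x + (\text{terms of degree} \ge 2)$ with $\exp(x)\cdot\exp(x) = \exp(2x)$, where $\exp(2x) = \sum_t 2^{\deg(t)} a(t)\, t$. Its coefficients are given by $a(1_M)=a(x)=1$ and $a(t_1\cdot t_2) = \frac{a(t_1)a(t_2)}{2^n-2}$ for $t_1,t_2 \ne 1_M$, $n = \deg(t_1\cdot t_2)$. For $t \in M$ of degree $n \ge 1$ put $\hat{a}(t) = n!\cdot\omega(n)\cdot a(t)$. *)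

(* Defs.v *)
From HB Require Import structures.
From mathcomp Require Import all_boot all_order all_algebra.

Set Implicit Arguments.
Unset Strict Implicit.
Unset Printing Implicit Defensive.

Import GRing.Theory Num.Theory.
Local Open Scope ring_scope.

(** * Mersenne numbers *)

Definition mersenne (n : nat) : nat := (2 ^ n - 1)%N.

Definition mfact (n : nat) : nat := (\prod_(1 <= i < n.+1) mersenne i)%N.

(* Meant for r <= n only.  A quotient in rat, so that integrality is not built
   into the definition. *)
Definition mbinom (n r : nat) : rat :=
  (mfact n)%:R / ((mfact r)%:R * (mfact (n - r))%:R).

(* Meant for n >= 1 only. *)
Definition omega (n : nat) : rat :=
  (2 ^+ n.-1 * (mfact n.-1)%:R) / (n`!)%:R.

(** * The free magma with neutral element on one generator *)

Inductive tree : Type := Leaf | Graft of tree & tree.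

Fixpoint tree_encode (t : tree) : GenTree.tree unit :=
  match t with
  | Leaf => GenTree.Leaf tt
  | Graft l r => GenTree.Node 0 [:: tree_encode l; tree_encode r]
  end.

Fixpoint tree_decode (g : GenTree.tree unit) : option tree :=
  match g with
  | GenTree.Leaf _ => Some Leaf
  | GenTree.Node _ [:: l; r] =>
      if tree_decode l is Some l' then
        if tree_decode r is Some r' then Some (Graft l' r') else None
      else None
  | _ => None
  end.

Lemma tree_encodeK : pcancel tree_encode tree_decode.
Proof. by elim=> //= l -> r ->. Qed.

HB.instance Definition _ := Countable.copy tree (pcan_type tree_encodeK).

(* [None] is the neutral element; every other element is a tree. *)
Definition fmagma : Type := option tree.

HB.instance Definition _ := Countable.on fmagma.

Definition fmul (s t : fmagma) : fmagma :=
  match s, t with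
  | None, _ => t
  | _, None => s
  | Some s', Some t' => Some (Graft s' t')
  end.

HB.instance Definition _ := hasMul.Build fmagma fmul.

Lemma fmul1g : left_id (None : fmagma) fmul.
Proof. by []. Qed.

Lemma fmulg1 : right_id (None : fmagma) fmul.
Proof. by case. Qed.

HB.instance Definition _ := Magma_isUMagma.Build fmagma fmul1g fmulg1.

Definition fgen : fmagma := Some Leaf.

Lemma fmagma_universal (G : umagmaType) (g : G) :
  exists f : fmagma -> G,
    [/\ f 1%g = 1%g, {morph f : s t / (s * t)%g}, f fgen = g
      & forall f' : fmagma -> G, f' 1%g = 1%g ->
          {morph f' : s t / (s * t)%g} -> f' fgen = g -> f' =1 f].
Proof.
pose h := fix h t : G := if t is Graft l r then (h l * h r)%g else g.
exists (fun t => if t is Some t' then h t' else 1%g); split=> //.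
- by move=> [s|] [t|] //=; rewrite ?monoid.mul1g ?monoid.mulg1.
- move=> f' f'1 f'M f'g [t|//]; elim: t => [//|l IHl r IHr] /=.
  by rewrite -IHl -IHr -f'M.
Qed.

Lemma fmagma_factor (t : fmagma) : t != 1%g -> t != fgen ->
  exists! p : fmagma * fmagma, [/\ p.1 != 1%g, p.2 != 1%g & t = (p.1 * p.2)%g].
Proof.
case: t => [[//|l r]|//] _ _; exists (Some l, Some r); split=> //.
by move=> [[s1|] [s2|]] [] //= _ _ [-> ->].
Qed.

Fixpoint leaves (t : tree) : nat :=
  if t is Graft l r then (leaves l + leaves r)%N else 1%N.

Definition deg (t : fmagma) : nat := if t is Some t' then leaves t' else 0%N.

Lemma deg1 : deg 1%g = 0%N. Proof. by []. Qed.

Lemma deg_gen : deg fgen = 1%N. Proof. by []. Qed.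

Lemma degM : {morph deg : s t / (s * t)%g >-> (s + t)%N}.
Proof. by move=> [s|] [t|] //=; rewrite addn0. Qed.

(* The left factor s1 of the factorization s1 * s2 into non-neutral elements;
   junk value 1 on 1 and on the generator, which have no such factorization. *)
Definition lfactor (t : fmagma) : fmagma :=
  if t is Some (Graft l _) then Some l else 1%g.

Lemma lfactorM (s1 s2 : fmagma) :
  s1 != 1%g -> s2 != 1%g -> lfactor (s1 * s2)%g = s1.
Proof. by case: s1 s2 => [s1|] [s2|]. Qed.

(** * Nodes *)

(* A node is encoded by the path leading to it from the root: [false] goes to
   the left subtree, [true] to the right one.  Hence the path from b to the
   root passes through a iff a is a prefix of b. *)
Definition node : Type := seq bool.

Fixpoint tree_nodes (t : tree) : seq node :=
  if t is Graft l r then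
    [::] :: [seq false :: a | a <- tree_nodes l]
         ++ [seq true :: a | a <- tree_nodes r]
  else [:: [::]].

Definition nodes (t : fmagma) : seq node :=
  if t is Some t' then tree_nodes t' else [::].

(* Junk value 1 if a is not a node of t. *)
Fixpoint tree_sub (t : tree) (a : node) : fmagma :=
  match a, t with
  | [::], _ => Some t
  | b :: a', Graft l r => tree_sub (if b then r else l) a'
  | _ :: _, Leaf => 1%g
  end.

Definition subtree (t : fmagma) (a : node) : fmagma :=
  if t is Some t' then tree_sub t' a else 1%g.

(* A node of t is a leaf iff no other node of t lies below it. *)
Definition is_leaf (t : fmagma) (a : node) : bool :=
  all (fun b => prefix a b ==> (b == a)) (nodes t).

Definition inner_nodes (t : fmagma) : seq node :=
  [seq a <- nodes t | ~~ is_leaf t a].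

Lemma mem_consl (b c : bool) (a : node) (s : seq node) :
  (b :: a \in [seq c :: d | d <- s]) = (b == c) && (a \in s).
Proof.
apply/mapP/andP => [[d ds [-> ->]]|[/eqP -> sa]]; first by rewrite eqxx.
by exists a.
Qed.

Lemma uniq_nodes (t : fmagma) : uniq (nodes t).
Proof.
case: t => //; elim=> //= l IHl r IHr.
rewrite mem_cat negb_or cat_uniq !map_inj_uniq ?IHl ?IHr; try by move=> ? ? [].
rewrite andbT -!andbA; apply/and4P; split=> //=.
- by apply/mapP => -[].
- by apply/mapP => -[].
- by apply/hasPn=> _ /mapP[d _ ->]; rewrite mem_consl.
Qed.

Lemma mem_subtree (t : fmagma) (a b : node) :
  (b \in nodes (subtree t a)) = (a ++ b \in nodes t).
Proof.
case: t => [t|//]; elim: a t => [|c a IH] [|l r] //=.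
by rewrite IH in_cons mem_cat !mem_consl; case: c; rewrite ?orbF.
Qed.

Lemma inner_nodesE (t : fmagma) (a : node) :
  (a \in inner_nodes t) = (a \in nodes t) && (subtree t a != fgen).
Proof.
rewrite mem_filter andbC; case: (boolP (a \in nodes t)) => //= at_.
have : subtree t a != 1%g.
  by have := mem_subtree t a [::]; rewrite cats0 at_; case: (subtree t a).
move Eu: (subtree t a) => [[|l r]|] // _.
  rewrite eqxx; apply/negbF/allP=> b bt; apply/implyP => /prefixP[c Eb].
  by move: bt; rewrite Eb -mem_subtree Eu /= mem_seq1 => /eqP->; rewrite cats0.
apply/allPn; exists (a ++ [:: false]).
  by rewrite -mem_subtree Eu /= in_cons mem_cat mem_consl; case: (l).
by rewrite prefix_prefix -{2}[a]cats0 eqseq_cat ?eqxx.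
Qed.

(** * Formal series and the non-associative exponential *)

(* The formal series is identified with its coefficients. *)
Definition series : Type := fmagma -> rat.

Definition factorizations (t : fmagma) : seq (fmagma * fmagma) :=
  match t with
  | None => [:: (None, None)]
  | Some Leaf => [:: (None, t); (t, None)]
  | Some (Graft l r) => [:: (None, t); (t, None); (Some l, Some r)]
  end.

Lemma uniq_factorizations (t : fmagma) : uniq (factorizations t).
Proof.
case: t => [[|l r]|] /=; rewrite ?inE ?xpair_eqE /= ?andbT //.
by rewrite negb_and orbT.
Qed.

Lemma mem_factorizations (t : fmagma) (p : fmagma * fmagma) :
  (p \in factorizations t) = ((p.1 * p.2)%g == t).
Proof.
apply/idP/eqP; last by case: p t => [[[|? ?]|] [[|? ?]|]] _ /= <-;
  rewrite !inE ?eqxx ?orbT.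
by case: t => [[|l r]|]; rewrite !inE;
  do ?[case/orP]; move=> /eqP-> //.
Qed.

Definition series_mul (f g : series) : series :=
  fun t => \sum_(p <- factorizations t) f p.1 * g p.2.

(* f(x) |-> f(c x) *)
Definition series_dilate (c : rat) (f : series) : series :=
  fun t => c ^+ deg t * f t.

(* 1 and x are the only elements of degree < 2. *)
Definition is_nexp (a : series) : Prop :=
  [/\ a 1%g = 1, a fgen = 1 & series_mul a a =1 series_dilate 2 a].

Fixpoint tree_coef (t : tree) : rat :=
  if t is Graft l r then
    tree_coef l * tree_coef r / (2 ^+ (leaves l + leaves r) - 2)
  else 1.

Definition nexp : series := fun t => if t is Some t' then tree_coef t' else 1.

Lemma leaves_gt0 (t : tree) : (0 < leaves t)%N.
Proof. by elim: t => //= l Hl r _; rewrite addn_gt0 Hl. Qed.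

Lemma nexp_den_neq0 (l r : tree) : 2 ^+ (leaves l + leaves r) - 2 != 0 :> rat.
Proof.
rewrite subr_eq0 -[X in _ != X]expr1 -!natrX eqr_nat eqn_exp2l //.
have lr_gt1 := leq_add (leaves_gt0 l) (leaves_gt0 r).
by rewrite eq_sym neq_ltn lr_gt1.
Qed.

(* Existence and uniqueness of the exponential. *)
Lemma is_nexpP (a : series) : is_nexp a <-> a =1 nexp.
Proof.
split=> [[a1 ax aM]|aE].
- case=> [|//]; elim=> [//|l IHl r IHr]; have := aM (Some (Graft l r)).
  rewrite /series_mul /series_dilate !big_cons big_nil /= a1 mul1r mulr1 addr0.
  rewrite IHl IHr addrA -mulr2n => aE.
  apply: (mulIf (nexp_den_neq0 l r)); rewrite mulfVK ?nexp_den_neq0 //.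
  rewrite [_ * (_ - _)]mulrBr [_ * 2 ^+ _]mulrC -aE mulr_natr.
  by rewrite addrAC subrr add0r.
- split; rewrite ?aE // => t; rewrite /series_mul /series_dilate.
  rewrite (eq_bigr (fun p => nexp p.1 * nexp p.2)) => [|p _]; last by rewrite !aE.
  rewrite aE; case: t => [[|l r]|]; rewrite !big_cons big_nil //=.
  rewrite addr0 mul1r mulr1 addrA.
  set c := _ / _; have -> : tree_coef l * tree_coef r =
      c * (2 ^+ (leaves l + leaves r) - 2) by rewrite mulfVK ?nexp_den_neq0.
  by rewrite -mulr2n -[c *+ 2]mulr_natr mulrBr addrC subrK mulrC.
Qed.

(* The normalized coefficients, for t != 1. *)
Definition ahat (a : series) (t : fmagma) : rat :=
  ((deg t)`!)%:R * omega (deg t) * a t.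

(* Main.v *)
Require Import Defs.
From mathcomp Require Import all_boot all_order all_algebra.
From mathcomp Require Import ring.

Import GRing.Theory Num.Theory.

Local Open Scope ring_scope.

(** The factorials cancel in the normalization, so that
    [ahat a t = 2 ^ (n - 1) * (n - 1)!_M * a t] for [t] of degree [n].  Let
    [t = l * r] with [l], [r] of degrees [n1], [n2].  The denominator in the
    recursion for [a] is [2 ^ n - 2 = 2 * M_(n - 1)]; it removes one factor 2
    and the top factor of [(n - 1)!_M], leaving
    [2 ^ (n - 2) * (n - 2)!_M * a l * a r].  The powers of 2 of [ahat a l] and
    [ahat a r] multiply to exactly [2 ^ (n - 2)], so
    [ahat a t = mbinom (n - 2) (n1 - 1) * ahat a l * ahat a r] ([ahat_Graft]):
    passing to the subtrees costs the factor of the root.  As the inner nodes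
    of [t] are the root and those of [l] and [r] ([inner_nodes_Graft]), the
    product formula follows by induction on [t].

    Integrality then reduces to that of each Mersenne binomial.  These are the
    Gaussian binomials at [q = 2], and are integers by the Pascal rule for them
    ([dvdn_mfactM]). *)

Lemma mersenne_gt0 n : (0 < mersenne n.+1)%N.
Proof. by rewrite subn_gt0 -{1}(expn0 2) ltn_exp2l. Qed.

Lemma mfactS n : mfact n.+1 = (mfact n * mersenne n.+1)%N.
Proof. by rewrite /mfact big_nat_recr. Qed.

Lemma mfact_gt0 n : (0 < mfact n)%N.
Proof.
elim: n => [|n IHn]; first by rewrite /mfact big_geq.
by rewrite mfactS muln_gt0 IHn mersenne_gt0.
Qed.

Lemma mfact_neq0 n : (mfact n)%:R != 0 :> rat.
Proof. by rewrite pnatr_eq0 -lt0n mfact_gt0. Qed.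

Lemma mersenneD m n :
  mersenne (m + n) = (mersenne m + 2 ^ m * mersenne n)%N.
Proof.
rewrite /mersenne expnD mulnBr muln1 addnC addnBA ?expn_gt0 // subnK //.
by rewrite leq_pmulr // expn_gt0.
Qed.

(** Multiplied by [(m + n + 1)!_M], the identity
    [M_(m+n+2) = M_(m+1) + 2 ^ (m+1) * M_(n+1)] is the Pascal rule cleared of
    denominators: each of the two summands is divisible by induction on
    [m + n]. *)
Lemma dvdn_mfactM m n : (mfact m * mfact n %| mfact (m + n))%N.
Proof.
have [s] := ubnP (m + n); elim: s m n => // s IHs [|m] [|n] lt_s.
- by rewrite addn0 {1}/mfact big_geq // mul1n.
- by rewrite add0n {1}/mfact big_geq // mul1n.
- by rewrite addn0 {2}/mfact big_geq // muln1.
rewrite addSn [mfact _.+1 in X in (_ %| X)%N]mfactS -addSn mersenneD mulnDr; apply: dvdn_add.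
- rewrite mfactS mulnAC dvdn_mul //; apply: IHs.
  by rewrite -ltnS.
- rewrite [mfact n.+1]mfactS mulnA mulnCA dvdn_mull // dvdn_mul //.
  by rewrite -addSnnS; apply: IHs; rewrite addSnnS -ltnS.
Qed.

Lemma mbinom_nat n r : (r <= n)%N -> mbinom n r \is a Num.nat.
Proof.
move=> le_rn; have := dvdn_mfactM r (n - r); rewrite subnKC // => /dvdnP[k Ek].
by rewrite /mbinom -natrM Ek natrM mulfK ?natr_nat // natrM mulf_neq0 ?mfact_neq0.
Qed.

(** Whether [v] is a leaf is read off the subtree at [v] alone, whereas
    [is_leaf] compares [v] with all nodes of [t]; only the former is visibly
    unchanged when [t] is grafted into a larger tree. *)
Lemma inner_nodes_filter t :
  inner_nodes t = [seq v <- nodes t | subtree t v != fgen].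
Proof.
apply: eq_in_filter => v vt.
by have := inner_nodesE t v; rewrite mem_filter vt andbT.
Qed.

Lemma inner_nodes_Graft l r :
  inner_nodes (Some (Graft l r)) =
    [::] :: [seq false :: v | v <- inner_nodes (Some l)]
         ++ [seq true :: v | v <- inner_nodes (Some r)].
Proof. by rewrite !inner_nodes_filter /= filter_cat !filter_map. Qed.

Lemma ahatE a t : ahat a t = 2 ^+ (deg t).-1 * (mfact (deg t).-1)%:R * a t.
Proof.
have fact_neq0 : ((deg t)`!)%:R != 0 :> rat by rewrite pnatr_eq0 -lt0n fact_gt0.
by rewrite /ahat /omega [_%:R * (_ / _)]mulrC divfK.
Qed.

(** The contribution of the root: [2 ^ n - 2 = 2 * M_(n - 1)] accounts for the
    passage from [n - 1] to [n - 2], and the factorials [(n1 - 1)!_M] and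
    [(n2 - 1)!_M] that normalize the two factors are the denominator of the
    binomial. *)
Lemma ahat_Graft l r :
  ahat nexp (Some (Graft l r)) =
    mbinom (leaves l + leaves r - 2) (leaves l - 1)
      * (ahat nexp (Some l) * ahat nexp (Some r)).
Proof.
rewrite !ahatE /= /mbinom; have := nexp_den_neq0 l r.
(* Degrees are positive: writing them m.+1 and n.+1 makes the truncated
   subtractions exact. *)
case: (leaves l) (leaves_gt0 l) => // m _.
case: (leaves r) (leaves_gt0 r) => // n _.
rewrite addSn addnS !subSS !subn0 addKn /= mfactS => den_neq0.
have mE : 2 ^+ (m + n).+2 - 2 = 2 * (mersenne (m + n).+1)%:R :> rat.
  by rewrite natrB ?expn_gt0 // natrX mulrBr mulr1 -exprS.
rewrite mE mulf_eq0 negb_or in den_neq0 *; have /andP[_ M_neq0] := den_neq0.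
have Fm := mfact_neq0 m; have Fn := mfact_neq0 n.
rewrite natrM exprS exprD; field.
by rewrite Fm Fn M_neq0.
Qed.

Lemma ahat_nexp_prod t :
  ahat nexp (Some t) =
    \prod_(v <- inner_nodes (Some t))
      mbinom (deg (subtree (Some t) v) - 2)
             (deg (lfactor (subtree (Some t) v)) - 1).
Proof.
elim: t => [|l IHl r IHr].
  by rewrite inner_nodes_filter big_nil ahatE /= /mfact big_geq // !mulr1.
by rewrite inner_nodes_Graft big_cons big_cat !big_map ahat_Graft IHl IHr.
Qed.

Lemma ahat_nexp_nat t : ahat nexp (Some t) \is a Num.nat.
Proof.
elim: t => [|l IHl r IHr]; first by rewrite ahatE /= /mfact big_geq // !mulr1.
rewrite ahat_Graft; apply: rpredM; last exact: rpredM.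
apply: mbinom_nat; case: (leaves l) (leaves_gt0 l) => // m _.
by case: (leaves r) (leaves_gt0 r) => // n _;
  rewrite addSn addnS !subSS !subn0 leq_addr.
Qed.

Theorem corollary3p4 (a : series) (a_exp : is_nexp a) (t : fmagma)
    (t_neq1 : t != 1%g) :
  ahat a t =
    \prod_(v <- inner_nodes t)
      mbinom (deg (subtree t v) - 2)%N (deg (lfactor (subtree t v)) - 1)%N
  /\ ahat a t \is a Num.nat.
Proof.
have -> : ahat a t = ahat nexp t by rewrite /ahat (is_nexpP a).1.
by case: t t_neq1 => // t _; rewrite ahat_nexp_nat -ahat_nexp_prod.
Qed.
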